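(* Let $A_0\in\mathbb{R}^{n\times n}$ and $B\in\mathbb{R}^{n\times m}$ be such that $(A_0,B)$ is uncontrollable, and let $\mathcal{S}$ be the set of real symmetric $X\in\mathbb{R}^{n\times n}$ with $-A_0^TX-XA_0+XBB^TX\le 0$. (1) If all uncontrollable eigenvalues lie in the open right half plane, then $\mathcal{S}$ is bounded from below. (2) If all uncontrollable eigenvalues lie in the open left half plane, then $\mathcal{S}$ is bounded from above. (3) If uncontrollable eigenvalues lie in both the (open left and open right) half planes, then $\mathcal{S}$ is neither bounded from below nor bounded from above.
   Context: For symmetric matrices, $X\le Y$ means $Y-X$ is positive semidefinite. A set of symmetric matrices is bounded from below (above) if there is a real symmetric matrix $N$ with $N\le X$ (respectively $X\le N$) for all $X$ in the set. After a change of basis, $A_0=\begin{bmatrix}A_0^{11}&A_0^{12}\\0&A_0^{22}\end{bmatrix}$, $B=\begin{bmatrix}B_1\\0\end{bmatrix}$ with $(A_0^{11},B_1)$ controllable; the uncontrollable eigenvalues are the eigenvalues of $A_0^{22}$; equivalently, $\lambda\in\mathbb{C}$ is an uncontrollable eigenvalue if there is $v\in\mathbb{C}^n$, $v\ne0$, with $A_0^Tv=\lambda v$ and $B^Tv=0$. *)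

(* Defs.v *)
From HB Require Import structures.
From mathcomp Require Import all_boot all_order all_algebra.
From mathcomp Require Import complex.
From mathcomp Require Import classical_sets reals.

Set Implicit Arguments.
Unset Strict Implicit.
Unset Printing Implicit Defensive.

Import Order.TTheory GRing.Theory Num.Theory.

Local Open Scope ring_scope.
Local Open Scope classical_set_scope.
Local Open Scope complex_scope.

Definition psdmx (R : realType) (n : nat) (M : 'M[R]_n) : Prop :=
  M \is symmetricmx /\ forall x : 'cV[R]_n, 0 <= (x^T *m M *m x) 0 0.

Definition loewner_le (R : realType) (n : nat) (X Y : 'M[R]_n) : Prop :=
  psdmx (Y - X).

Definition bounded_below (R : realType) (n : nat) (S : set 'M[R]_n) : Prop :=
  exists N : 'M[R]_n,
    N \is symmetricmx /\ forall X, S X -> loewner_le N X.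

Definition bounded_above (R : realType) (n : nat) (S : set 'M[R]_n) : Prop :=
  exists N : 'M[R]_n,
    N \is symmetricmx /\ forall X, S X -> loewner_le X N.

(* The n x (n * m) block matrix [B, A B, ..., A^(n-1) B]. *)
Definition controllability_mx (R : realType) (n m : nat)
    (A : 'M[R]_n) (B : 'M[R]_(n, m)) : 'M[R]_(n, \sum_(i < n) m) :=
  \mxrow_(i < n) (A ^+ i *m B).

Definition controllable (R : realType) (n m : nat)
    (A : 'M[R]_n) (B : 'M[R]_(n, m)) : Prop :=
  \rank (controllability_mx A B) = n.

(* Equivalently, lam is an eigenvalue of the block A22 of a decomposition
   A ~ [A11, A12; 0, A22], B ~ [B1; 0] with (A11, B1) controllable.  The
   transposes are plain, not conjugated, so lam itself (and not its conjugate)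
   is an eigenvalue of A. *)
Definition uncontrollable_eigenvalue (R : realType) (n m : nat)
    (A : 'M[R]_n) (B : 'M[R]_(n, m)) (lam : R[i]) : Prop :=
  exists v : 'cV[R[i]]_n,
    [/\ v != 0,
        (map_mx (real_complex R) A)^T *m v = lam *: v
      & (map_mx (real_complex R) B)^T *m v = 0].

Definition riccati_ineq_set (R : realType) (n m : nat)
    (A : 'M[R]_n) (B : 'M[R]_(n, m)) : set 'M[R]_n :=
  [set X | X \is symmetricmx /\
     loewner_le (- (A^T *m X) - X *m A + X *m B *m B^T *m X) 0].

(* Main.v *)
(** If every uncontrollable eigenvalue is in the open left half plane, some
    feedback K makes A_K = A + BK stable: an eigenvalue that is not in the left
    half plane has a left eigenvector v with vB <> 0, and by Brauer's theorem
    a rank-one feedback through v moves it to -1 and keeps the rest of the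
    spectrum.  Stability gives P > 0 with A_K^* P + P A_K < 0.  Completing the
    square, every X in S satisfies A_K^* X + X A_K >= - K^* K, so for c large
    A_K^* (X - cP) + (X - cP) A_K >= 0, which forces X <= cP.  Hence (2), and
    (1) follows by the symmetry (A, X) -> (- A, - X).  For (3), if
    A^T v = lam v, B^T v = 0 and v = p + iq, then S = p p^T + q q^T satisfies
    S B = 0 and A^T S + S A = 2 Re(lam) S, so that t S belongs to the set
    whenever t Re(lam) >= 0: a ray going down when Re(lam) < 0 and up when
    Re(lam) > 0. *)

Require Import Defs.
From HB Require Import structures.
From mathcomp Require Import all_boot all_order all_algebra.
From mathcomp Require Import complex.
From mathcomp Require Import classical_sets reals.
From mathcomp Require Import ring.

Set Implicit Arguments.
Unset Strict Implicit.
Unset Printing Implicit Defensive.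

Import Order.TTheory GRing.Theory Num.Theory.

Local Open Scope ring_scope.
Local Open Scope sesquilinear_scope.

(** * Rank-one updates of the characteristic polynomial *)

(** Eliminating either diagonal block of the bordered matrix [M] gives its determinant in two ways.
    The factor [y] on the left avoids dividing by [y]. *)
Lemma det_scalar_sub_rank1 (R : comNzRingType) n (y : R)
    (u : 'cV[R]_n) (v : 'rV[R]_n) :
  y * \det (y%:M - u *m v) = (y - (v *m u) 0 0) * y ^+ n.
Proof.
pose M := block_mx 1%:M v u y%:M : 'M_(1 + n).
have <- : \det M = \det (y%:M - u *m v).
  transitivity (\det (M *m block_mx 1%:M (- v) 0 1%:M)).
    by rewrite det_mulmx det_ublock !det1 !mulr1.
  rewrite mulmx_block !mulmx0 !mulmx1 !addr0 mul1mx addNr det_lblock det1 mul1r.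
  by rewrite mulmxN addrC.
transitivity (\det (M *m block_mx y%:M 0 (- u) 1%:M)).
  by rewrite det_mulmx det_lblock det1 mulr1 det_scalar1 mulrC.
rewrite mulmx_block mul1mx !mulmx1 !mulmxN mul_mx_scalar.
rewrite !mul_scalar_mx subrr mulmx0 add0r scaler0 add0r det_ublock det_scalar.
by rewrite [_ - _]mx11_scalar det_scalar1 !mxE eqxx mulr1n.
Qed.

(* Brauer's theorem: [A + u v] has the spectrum of [A] with [l] replaced by
   [l + v u].  With [y = X - l] the left eigenvector relation reads
   [v (X - A) = y v], so [y (X - A - u v) = (y - u v) (X - A)]. *)
Lemma char_poly_rank1_update (R : idomainType) n (A : 'M[R]_n) (l : R)
    (u : 'cV[R]_n) (v : 'rV[R]_n) :
  v *m A = l *: v ->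
  ('X - l%:P) * char_poly (A + u *m v)
    = ('X - (l + (v *m u) 0 0)%:P) * char_poly A.
Proof.
move=> vA; set y := 'X - l%:P.
pose u' := map_mx polyC u; pose v' := map_mx polyC v.
pose M := char_poly_mx A.
have vM : v' *m M = y *: v'.
  by rewrite mulmxBr mul_mx_scalar -map_mxM vA map_mxZ scalerBl.
have E : y *: (M - u' *m v') = (y%:M - u' *m v') *m M.
  by rewrite scalerBr mulmxBl mul_scalar_mx -mulmxA vM scalemxAr.
have M' : char_poly (A + u *m v) = \det (M - u' *m v').
  by rewrite /char_poly /char_poly_mx map_mxD map_mxM opprD addrA.
have := congr1 (fun N => y * \det N) E.
rewrite detZ det_mulmx [RHS]mulrA det_scalar_sub_rank1 -M' => H.
have y0 : y ^+ n != 0 by rewrite expf_neq0 // polyXsubC_eq0.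
apply: (mulfI y0); rewrite mulrCA H /char_poly -/M -map_mxM mxE polyCD.
by rewrite opprD addrA /= -/y [RHS]mulrCA mulrA.
Qed.

(** * Hermitian forms and spectral bounds *)

Section Lyapunov.
Variable C : numClosedFieldType.

Lemma trmxC_mul m n p (M : 'M[C]_(m, n)) (N : 'M[C]_(n, p)) :
  (M *m N)^t* = N^t* *m M^t*.
Proof. by rewrite trmx_mul map_mxM. Qed.

Lemma trmxCD m n (M N : 'M[C]_(m, n)) : (M + N)^t* = M^t* + N^t*.
Proof. by rewrite linearD map_mxD. Qed.

Lemma trmxCN m n (M : 'M[C]_(m, n)) : (- M)^t* = - M^t*.
Proof. by rewrite linearN map_mxN. Qed.

Lemma trmxCZ m n (c : C) (M : 'M[C]_(m, n)) : (c *: M)^t* = c^* *: M^t*.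
Proof. by rewrite linearZ map_mxZ. Qed.

Lemma hermsymmxP n (M : 'M[C]_n) : reflect (M^t* = M) (M \is hermsymmx).
Proof.
by apply: (iffP (is_hermitianmxP _ _ _)); rewrite expr0 scale1r => /esym.
Qed.

Definition qf n (Q : 'M[C]_n) (x : 'cV[C]_n) : C := (x^t* *m Q *m x) 0 0.

Lemma qfD n (P Q : 'M[C]_n) x : qf (P + Q) x = qf P x + qf Q x.
Proof. by rewrite /qf mulmxDr mulmxDl mxE. Qed.

Lemma qfN n (Q : 'M[C]_n) x : qf (- Q) x = - qf Q x.
Proof. by rewrite /qf mulmxN mulNmx mxE. Qed.

Lemma qfZ n c (Q : 'M[C]_n) x : qf (c *: Q) x = c * qf Q x.
Proof. by rewrite /qf -scalemxAr -scalemxAl mxE. Qed.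

Lemma qf_conj m n (T : 'M[C]_(m, n)) Q x :
  qf (T^t* *m Q *m T) x = qf Q (T *m x).
Proof. by rewrite /qf trmxC_mul !mulmxA. Qed.

Lemma qf_diag n (d : 'rV[C]_n) x :
  qf (diag_mx d) x = \sum_i d 0 i * `|x i 0| ^+ 2.
Proof.
rewrite /qf mul_mx_diag mxE; apply: eq_bigr => i _.
by rewrite !mxE normCK; ring.
Qed.

Lemma qf1 n (x : 'cV[C]_n) : qf 1%:M x = \sum_i `|x i 0| ^+ 2.
Proof.
rewrite -diag_const_mx qf_diag; apply: eq_bigr => i _.
by rewrite !mxE mul1r.
Qed.

Lemma qf1_ge0 n (x : 'cV[C]_n) : 0 <= qf 1%:M x.
Proof. by rewrite qf1 sumr_ge0 // => i _; rewrite exprn_ge0. Qed.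

Lemma qf_mulCmx_ge0 m n (M : 'M[C]_(m, n)) x : 0 <= qf (M^t* *m M) x.
Proof. by rewrite -[M^t*]mulmx1 qf_conj qf1_ge0. Qed.

Lemma qf_delta n (Q : 'M[C]_n) i : qf Q (delta_mx i 0) = Q i i.
Proof.
rewrite /qf -mulmxA -colE mxE (bigD1 i) //= big1 => [|j ji].
  by rewrite !mxE !eqxx conjC1 mul1r addr0.
by rewrite !mxE (negPf ji) conjC0 mul0r.
Qed.

Lemma hermsymmx_spectral n (M : 'M[C]_n) : M \is hermsymmx ->
  exists (U : 'M[C]_n) (d : 'rV[C]_n),
    [/\ U \is unitarymx, M = U^t* *m diag_mx d *m U & d \is a mxOver Num.real].
Proof.
move=> Mh; exists (spectralmx M), (spectral_diag M); split.
- exact: spectral_unitarymx.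
- rewrite -invmx_unitary ?spectral_unitarymx //.
  exact/orthomx_spectralP/hermitian_normalmx.
- exact: hermitian_spectral_diag_real.
Qed.

Lemma qf1_unitary n (U : 'M[C]_n) x : U \is unitarymx ->
  qf 1%:M (U *m x) = qf 1%:M x.
Proof.
move=> Uu; rewrite -qf_conj mulmx1 -invmx_unitary // mulVmx //.
exact: unitarymx_unit.
Qed.

Lemma herm_bounded n (M : 'M[C]_n) : M \is hermsymmx ->
  exists2 c, 0 < c & forall x, qf M x <= c * qf 1%:M x.
Proof.
move=> /hermsymmx_spectral [U [d [Uu -> /mxOverP dr]]].
(* The sum dominates every eigenvalue; the extra 1 keeps the constant positive even if all of them
   vanish. *)
exists (1 + \sum_i `|d 0 i|).
  by rewrite ltr_pwDl ?ltr01 ?sumr_ge0.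
move=> x; rewrite qf_conj -(qf1_unitary x Uu); set y := U *m x.
rewrite qf_diag qf1 mulr_sumr ler_sum // => i _.
rewrite ler_wpM2r ?exprn_ge0 // (le_trans (real_ler_norm (dr _ _))) //.
by rewrite (bigD1 i) //= addrCA lerDl addr_ge0 ?sumr_ge0.
Qed.

Definition posdef n (Q : 'M[C]_n) := forall x, x != 0 -> 0 < qf Q x.

Lemma posdef_coercive n (Q : 'M[C]_n) : Q \is hermsymmx -> posdef Q ->
  exists2 c, 0 < c & forall x, qf 1%:M x <= c * qf Q x.
Proof.
move=> /hermsymmx_spectral [U [d [Uu -> _]]] Qp.
have Ui := unitarymx_unit Uu.
(* The form is tested at the vector that [U] sends to the [i]-th basis vector, where its value is
   [d 0 i]. *)
have dp i : 0 < d 0 i.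
  have := Qp (invmx U *m delta_mx i 0); rewrite qf_conj mulKVmx // qf_delta.
  rewrite mxE eqxx; apply; apply/eqP => /(congr1 (mulmx U)).
  rewrite mulKVmx // mulmx0 => /matrixP /(_ i 0) /eqP.
  by rewrite !mxE !eqxx oner_eq0.
have dVp i : 0 <= (d 0 i)^-1 by rewrite invr_ge0 ltW.
exists (1 + \sum_i (d 0 i)^-1).
  by rewrite ltr_pwDl ?ltr01 ?sumr_ge0.
move=> x; rewrite qf_conj -(qf1_unitary x Uu); set y := U *m x.
rewrite qf_diag qf1 mulr_sumr ler_sum // => i _.
rewrite mulrA ler_peMl ?exprn_ge0 // -ler_pdivrMr // mul1r.
by rewrite (bigD1 i) //= addrCA lerDl addr_ge0 ?sumr_ge0.
Qed.

Lemma herm_dominated n (Q M : 'M[C]_n) :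
  Q \is hermsymmx -> posdef Q -> M \is hermsymmx ->
  exists2 c, 0 < c & forall x, qf M x <= c * qf Q x.
Proof.
move=> Qh /(posdef_coercive Qh) [a a0 Ha] /herm_bounded [b b0 Hb].
exists (b * a); rewrite ?mulr_gt0 // => x.
by rewrite (le_trans (Hb x)) // -mulrA ler_pM2l.
Qed.

(** Congruence by the inverse of [T] turns [T^* T] into the identity, which the unitary [U]
    diagonalizing the transformed [Y] preserves; hence [W = U T]. *)
Lemma simultaneous_diag n (T Y : 'M[C]_n) : T \in unitmx -> Y \is hermsymmx ->
  exists (W : 'M[C]_n) (d : 'rV[C]_n),
    [/\ W \in unitmx, W^t* *m W = T^t* *m T, Y = W^t* *m diag_mx d *m W
      & d \is a mxOver Num.real].
Proof.
move=> Ti /hermsymmxP Yh.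
have : (invmx T)^t* *m Y *m invmx T \is hermsymmx.
  by apply/hermsymmxP; rewrite !trmxC_mul trmxCK Yh mulmxA.
move=> /hermsymmx_spectral [U [d [Uu YE dr]]]; exists (U *m T), d.
have Ui := unitarymx_unit Uu.
have TT : T^t* *m (invmx T)^t* = 1%:M.
  by rewrite -trmxC_mul mulVmx // trmx1 map_mx1.
split=> //.
- by rewrite unitmx_mul Ui.
- rewrite trmxC_mul -mulmxA [U^t* *m _]mulmxA -(invmx_unitary Uu) mulVmx //.
  by rewrite mul1mx.
- rewrite trmxC_mul -2!mulmxA (mulmxA (diag_mx d)) (mulmxA (U^t* )).
  rewrite (mulmxA (U^t* ) (diag_mx d)) -YE -mulmxA mulVmx // mulmx1.
  by rewrite mulmxA TT mul1mx.
Qed.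

(** * The Lyapunov operator *)

Definition lyap n (A X : 'M[C]_n) := A^t* *m X + X *m A.

Lemma lyap_herm n (A X : 'M[C]_n) : X \is hermsymmx -> lyap A X \is hermsymmx.
Proof.
move=> /hermsymmxP Xh; apply/hermsymmxP.
by rewrite trmxCD !trmxC_mul trmxCK Xh addrC.
Qed.

(* In a basis where [T^* T] is the identity and [Y] is diagonal, the [i]-th
   diagonal entry of [lyap A Y] is [d_i] times a negative number. *)
Lemma lyap_ge0_nonpos n (A T Y : 'M[C]_n) :
  T \in unitmx -> posdef (- lyap A (T^t* *m T)) -> Y \is hermsymmx ->
  (forall x, 0 <= qf (lyap A Y) x) -> forall x, qf Y x <= 0.
Proof.
move=> Ti Pp /(simultaneous_diag Ti) [W [d [Wi WT YE /mxOverP dr]]] Yp x.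
have [G AE] : exists G, W *m A = G *m W.
  by exists (W *m A *m invmx W); rewrite mulmxKV.
have AE' : A^t* *m W^t* = W^t* *m G^t* by rewrite -!trmxC_mul AE.
rewrite YE qf_conj qf_diag sumr_le0 // => i _.
rewrite mulr_le0_ge0 ?exprn_ge0 //.
pose e := delta_mx i 0 : 'cV[C]_n.
have e0 : invmx W *m e != 0.
  apply/eqP => /(congr1 (mulmx W)); rewrite mulKVmx // mulmx0.
  by move=> /matrixP /(_ i 0) /eqP; rewrite !mxE !eqxx oner_eq0.
have lyapE D : lyap A (W^t* *m D *m W) = W^t* *m lyap G D *m W.
  rewrite /lyap mulmxDr mulmxDl !mulmxA AE' -[_ *m W *m A]mulmxA AE.
  by rewrite !mulmxA.
have := Pp _ e0; have := Yp (invmx W *m e).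
rewrite -WT YE -[in X in 0 < X](mulmx1 (W^t* )) !lyapE qfN !qf_conj.
rewrite mulKVmx // !qf_delta /lyap mulmx1 mul1mx mul_mx_diag mul_diag_mx !mxE.
rewrite [_ * d 0 i]mulrC -mulrDr oppr_gt0 => d_ge0 G_lt0.
by move: d_ge0; rewrite nmulr_lge0.
Qed.

Lemma qf_block m n (a : 'M[C]_m) (b : 'M[C]_(m, n)) (c : 'M[C]_(n, m))
    (d : 'M[C]_n) x y :
  qf (block_mx a b c d) (col_mx x y)
    = qf a x + (x^t* *m b *m y) 0 0 + (y^t* *m c *m x) 0 0 + qf d y.
Proof.
rewrite /qf tr_col_mx map_row_mx mul_row_block mul_row_col !mulmxDl !mxE.
by rewrite !addrA [RHS]addrAC; ring.
Qed.

(** The square that absorbs the cross terms in the induction of [lyap_trig]. As [z] has a single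
    entry, [b^* b] factors out as a scalar. *)
Lemma qf1_sub_scale n (c : C) (b y : 'cV[C]_n) (z : 'cV[C]_1) :
  c \is Num.real ->
  qf 1%:M (y - c *: (b *m z))
    = qf 1%:M y - c * ((z^t* *m b^t* *m y) 0 0 + (y^t* *m b *m z) 0 0)
      + c * (c * (b^t* *m b) 0 0 * qf 1%:M z).
Proof.
move=> /CrealP cr.
have ZE (k : C) (M : 'M[C]_1) : (k *: M) 0 0 = k * M 0 0 by rewrite mxE.
have DE (M M' : 'M[C]_1) : (M + M') 0 0 = M 0 0 + M' 0 0 by rewrite mxE.
have NE (M : 'M[C]_1) : (- M) 0 0 = - M 0 0 by rewrite mxE.
have E4 : (z^t* *m b^t* *m b *m z) 0 0 = (b^t* *m b) 0 0 * (z^t* *m z) 0 0.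
  rewrite -(mulmxA (z^t* )) [b^t* *m b in LHS]mx11_scalar mul_mx_scalar.
  by rewrite -scalemxAl ZE.
rewrite /qf !mulmx1 trmxCD trmxCN trmxCZ cr mulmxDl !mulmxDr trmxC_mul.
rewrite !mulNmx !mulmxN -!scalemxAl -!scalemxAr !mulmxA.
by rewrite !(DE, NE, ZE) E4; ring.
Qed.

Lemma opp_addcJ_gt0 (l : C) : 'Re l < 0 -> 0 < - (l^* + l).
Proof.
move=> lr; rewrite addrC (_ : l + l^* = 'Re l * 2).
  by rewrite -mulNr mulr_gt0 ?oppr_gt0.
by rewrite ReE divfK // pnatr_eq0.
Qed.

(** Induction on the size: the certificate [P'] of the trailing block is extended block-diagonally
    by a scalar [p]. The off-diagonal block of the result does not involve [p], so [p] is free to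
    make the corner dominate it. *)
Lemma lyap_trig n (L : 'M[C]_n) : is_trig_mx L -> (forall i, 'Re (L i i) < 0) ->
  exists2 T : 'M[C]_n, T \in unitmx & posdef (- lyap L (T^t* *m T)).
Proof.
move=> Lt; elim/trigsqmx_ind: n L / Lt => [|n l a L' _ IHn] Lr.
  by exists 1%:M; rewrite ?unitmx1 // => x; rewrite [x]flatmx0 eqxx.
have [|T' T'i] := IHn.
  by move=> i; have := Lr (rshift 1 i); rewrite block_mxEdr.
have l0 : 'Re (l 0 0) < 0.
  by have := Lr (lshift n 0); rewrite block_mxEul.
set P' := T'^t* *m T' => H'p.
have P'h : P' \is hermsymmx by apply/hermsymmxP; rewrite trmxC_mul trmxCK.
have [|c c0 Hc] := posdef_coercive _ H'p.
  by apply/hermsymmxP; rewrite trmxCN (hermsymmxP _ (lyap_herm _ P'h)).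
pose b := P' *m a.
pose beta := c * (b^t* *m b) 0 0.
have beta0 : 0 <= beta.
  have := qf_mulCmx_ge0 b 1%:M.
  by rewrite /beta pmulr_rge0 // /qf trmx1 map_mx1 mul1mx mulmx1.
pose p := (beta + 1) / (- ((l 0 0)^* + l 0 0)).
have ll := opp_addcJ_gt0 l0.
have p0 : 0 < p by rewrite divr_gt0 // ltr_wpDl.
(* [p] is large enough to absorb the off-diagonal block [P' a] of
   [lyap L (diag (p, P'))]. *)
exists (block_mx (sqrtC p)%:M 0 0 T').
  rewrite unitmxE det_ublock unitrM -!unitmxE T'i andbT.
  by rewrite unitmxE det_scalar1 unitfE sqrtC_eq0 gt_eqF.
have -> : (block_mx (sqrtC p)%:M 0 0 T')^t* *m block_mx (sqrtC p)%:M 0 0 T'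
  = block_mx p%:M 0 0 P' :> 'M_(1 + n).
  rewrite tr_block_mx map_block_mx mulmx_block !trmx0 !map_mx0 !mulmx0 !mul0mx.
  rewrite !addr0 add0r tr_scalar_mx map_scalar_mx -scalar_mxM /=.
  rewrite (CrealP _) ?ger0_real ?sqrtC_ge0 ?ltW //.
  by rewrite -expr2 sqrtCK.
move=> x; rewrite -[x](@vsubmxK _ 1 n 1); move: (usubmx _) (dsubmx _) => x0 y.
have -> : lyap (block_mx l 0 a L') (block_mx p%:M 0 0 P')
  = block_mx ((p * ((l 0 0)^* + l 0 0))%:M) (b^t* ) b (lyap L' P') :> 'M_(1 + n).
  rewrite /lyap tr_block_mx map_block_mx !mulmx_block add_block_mx.
  rewrite !trmx0 !map_mx0 !mulmx0 !mul0mx !addr0 !add0r trmxC_mul.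
  rewrite (hermsymmxP _ P'h); congr block_mx.
  apply/matrixP => i j; rewrite !ord1 mul_mx_scalar mul_scalar_mx !mxE.
  by rewrite eqxx mulr1n mulrDr.
rewrite opp_block_mx qf_block !mulmxN !mulNmx qfN.
set q := qf (- _) y; rewrite ![(- (_ *m _ *m _)) _ _]mxE.
pose N := qf 1%:M x0.
set s := (x0^t* *m _ *m y) 0 0; set t := (y^t* *m _ *m x0) 0 0.
have -> : qf (p * ((l 0 0)^* + l 0 0))%:M x0 = - (beta + 1) * N.
  rewrite -scalemx1 qfZ; congr (_ * _).
  by rewrite -[(l 0 0)^* + _]opprK mulrN divfK // gt_eqF.
rewrite mulNr opprK.
have [x00|xn0] := eqVneq x0 0.
  rewrite /N /s /t /qf x00 !mulmx0 trmx0 map_mx0 !mul0mx !mxE.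
  rewrite !oppr0 mulr0 !add0r => xy; apply: H'p; apply: contra_neq xy => ->.
  by rewrite col_mx0.
move=> _.
have N0 : 0 < N.
  rewrite /N qf1 big_ord1 exprn_gt0 // normr_gt0.
  by apply: contra_neq xn0 => x00; rewrite [x0]mx11_scalar x00; exact: raddf0.
(* Completing the square: [c] times the form, minus [c N], equals the squared norm of [y - c b x0]
   plus [c q] minus the squared norm of [y]. The last difference is nonnegative by the choice of
   [c]. *)
have K : 0 <= qf 1%:M (y - c *: (b *m x0)) by exact: qf1_ge0.
rewrite qf1_sub_scale ?gtr0_real // -/s -/t -/beta -/N in K.
rewrite -(pmulr_rgt0 _ c0); apply: lt_le_trans (mulr_gt0 c0 N0) _.
rewrite -subr_ge0; apply: le_trans K _; rewrite -subr_ge0.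
rewrite (_ : _ - _ = c * q - qf 1%:M y) ?subr_ge0 //.
by ring.
Qed.

Lemma eigenvalue_trig_conj n (A P : 'M[C]_n) i : P \in unitmx ->
  is_trig_mx (conjmx P A) -> eigenvalue A (conjmx P A i i).
Proof.
move=> Pu Pt; apply: (@eigenvalue_conjmx _ _ _ P).
- by rewrite stablemx_unit.
- by rewrite row_free_unit.
rewrite -[_ \in _]/(eigenvalue _ _) eigenvalue_root_char char_poly_trig //.
by rewrite (bigD1 i) //= rootM root_XsubC eqxx.
Qed.

(** * Stability and stabilization by feedback *)

Definition stable n (A : 'M[C]_n) := forall l, eigenvalue A l -> 'Re l < 0.

(** A Schur basis makes [A] triangular with its eigenvalues on the diagonal, and the triangular
    certificate is pulled back along the unitary [P]. Size 0 is separate because [Schur] takes a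
    positive size. *)
Lemma lyap_stable n (A : 'M[C]_n) : stable A ->
  exists2 T : 'M[C]_n, T \in unitmx & posdef (- lyap A (T^t* *m T)).
Proof.
move=> As; case: (posnP n) => [n0|n0].
  move: A As; rewrite n0 => A As.
  exists 1%:M; rewrite ?unitmx1 // => x.
  by rewrite [x]flatmx0 eqxx.
have [P Pu Pt] := Schur A n0.
have Pi := unitarymx_unit Pu.
have [i|T Ti Tp] := lyap_trig Pt.
  exact/As/eigenvalue_trig_conj.
exists (T *m P); rewrite ?unitmx_mul ?Ti // => x x0.
have := Tp (P *m x); rewrite conjumx //.
have -> : P *m x != 0.
  apply: contra_neq x0 => /(congr1 (mulmx (invmx P))).
  by rewrite mulKmx // mulmx0.
move=> /(_ isT); rewrite -qf_conj; congr (0 < qf _ x).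
rewrite mulmxN mulNmx; congr (- _); rewrite /lyap mulmxDr mulmxDl !trmxC_mul.
have -> : (invmx P)^t* = P by rewrite invmx_unitary // trmxCK.
by rewrite !mulmxA mulmxKV // -(invmx_unitary Pu) mulVmx // mul1mx.
Qed.

Lemma stabilizable n m (A : 'M[C]_n) (B : 'M[C]_(n, m)) :
  (forall l (v : 'rV_n), v != 0 -> v *m A = l *: v -> v *m B = 0 ->
     'Re l < 0) ->
  exists K : 'M[C]_(m, n), stable (A + B *m K).
Proof.
have [rs charA] := closed_field_poly_normal (char_poly A).
rewrite (monicP (char_poly_monic A)) scale1r in charA.
(* The induction is on the number of roots, with multiplicity, outside the open left half plane. *)
have [k] := ubnP (count (fun z => ~~ ('Re z < 0)) rs).
elim: k => // k IHk in A rs charA *; rewrite ltnS => ck ctl.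
have [allr|] := boolP (all (fun z => 'Re z < 0) rs).
  exists 0 => l; rewrite mulmx0 addr0 eigenvalue_root_char charA.
  by rewrite root_prod_XsubC; exact: (allP allr).
move=> /allPn [l lrs lbad].
have /eigenvalueP [v vA v0] : eigenvalue A l.
  by rewrite eigenvalue_root_char charA root_prod_XsubC.
have /matrix0Pn [i [j]] : v *m B != 0 by apply: contraNneq lbad; apply: ctl vA.
rewrite ord1 {i} => vB.
(* The feedback [w v] moves the eigenvalue [l] to [-1]. *)
pose w : 'cV_m := ((-1 - l) / (v *m B) 0 j) *: delta_mx j 0.
have vBw : (v *m (B *m w)) 0 0 = -1 - l.
  by rewrite /w -scalemxAr -scalemxAr mulmxA -colE mxE [X in _ * X]mxE divfK.
have := char_poly_rank1_update (B *m w) vA.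
rewrite vBw addrCA subrr addr0 charA (perm_big _ (perm_to_rem lrs)) big_cons.
rewrite mulrCA => /(mulfI _); rewrite polyXsubC_eq0 => /(_ isT) charA'.
have [|||K HK] := IHk (A + B *m w *m v) (-1 :: rem l rs).
- by rewrite big_cons.
- rewrite (leq_trans _ ck) // (permP (perm_to_rem lrs)) /= lbad.
  by rewrite (Creal_ReP _ _) ?rpredN ?rpred1 // oppr_lt0 ltr01.
(* The hypothesis survives the feedback: on a row vector killed by [B], the updated matrix acts as
   [A]. *)
- move=> l' u u0 uA uB; apply: (ctl _ u) => //.
  by rewrite -uA mulmxDr !mulmxA uB !mul0mx addr0.
by exists (w *m v + K); rewrite mulmxDr addrA mulmxA.
Qed.

Lemma riccati_ineq_upper_bound n m (A : 'M[C]_n) (B : 'M[C]_(n, m)) :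
  (forall l (v : 'rV_n), v != 0 -> v *m A = l *: v -> v *m B = 0 ->
     'Re l < 0) ->
  exists2 c, 0 < c & forall X, X \is hermsymmx ->
    (forall x, 0 <= qf (lyap A X - X *m B *m B^t* *m X) x) ->
    forall x, qf X x <= c * qf 1%:M x.
Proof.
move=> /stabilizable [K /lyap_stable [T Ti Tp]].
set AK := A + B *m K in Tp; pose P := T^t* *m T.
have Ph : P \is hermsymmx by apply/hermsymmxP; rewrite trmxC_mul trmxCK.
have Qh : - lyap AK P \is hermsymmx.
  by apply/hermsymmxP; rewrite trmxCN (hermsymmxP _ (lyap_herm _ Ph)).
have KKh : K^t* *m K \is hermsymmx.
  by apply/hermsymmxP; rewrite trmxC_mul trmxCK.
(* [c] lets the strict Lyapunov decrease of [c P] absorb [K^* K], and [a] compares [P] with the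
   identity; neither depends on [X]. *)
have [c c0 Hc] := herm_dominated Qh Tp KKh.
have [a a0 Ha] := herm_bounded Ph.
exists (c * a); rewrite ?mulr_gt0 // => X Xh Xr x.
have cr : c^* = c by apply/CrealP/gtr0_real.
suff : qf (X - c *: P) x <= 0.
  rewrite qfD qfN qfZ subr_le0 => /le_trans; apply.
  by rewrite -mulrA ler_pM2l.
apply: lyap_ge0_nonpos x; [exact: Ti | exact: Tp | | move=> x].
  apply/hermsymmxP; rewrite trmxCD trmxCN trmxCZ cr.
  by rewrite (hermsymmxP _ Xh) (hermsymmxP _ Ph).
(* Completing the square in [B^* X] turns the Riccati inequality into a
   Lyapunov inequality for the closed loop [A + B K]. *)
have -> : lyap AK (X - c *: P) = (lyap A X - X *m B *m B^t* *m X)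
  + (K + B^t* *m X)^t* *m (K + B^t* *m X) + (c *: (- lyap AK P) - K^t* *m K).
  have -> : lyap AK (X - c *: P) = lyap AK X + c *: (- lyap AK P).
    rewrite /lyap mulmxBr mulmxBl -scalemxAr -scalemxAl scalerN scalerDr opprD.
    by rewrite addrACA.
  rewrite addrA addrAC; congr (_ + _).
  rewrite /lyap /AK !trmxCD !trmxC_mul trmxCK (hermsymmxP _ Xh).
  rewrite !mulmxDl !mulmxDr !mulmxA; apply/matrixP => i j.
  have DE (M M' : 'M[C]_n) : (M + M') i j = M i j + M' i j by rewrite mxE.
  have NE (M : 'M[C]_n) : (- M) i j = - M i j by rewrite mxE.
  by rewrite !(DE, NE); ring.
rewrite qfD addr_ge0 //; first by rewrite qfD addr_ge0 ?Xr ?qf_mulCmx_ge0.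
by rewrite qfD qfZ (qfN (K^t* *m K)) subr_ge0.
Qed.

End Lyapunov.

(** * Passage between real and complex matrices *)

Local Open Scope complex_scope.

Section Complexify.
Variable R : realType.
Local Notation toC := (real_complex R).
Local Notation cmx := (map_mx (real_complex R)).

Lemma ReC (z : R[i]) : 'Re z = (complex.Re z)%:C.
Proof. by rewrite complexRe. Qed.

Lemma conjC_toC (x : R) : (x%:C)^*%R = x%:C.
Proof. exact: conjc_real. Qed.

Lemma trmxC_toC m n (M : 'M[R]_(m, n)) : (cmx M)^t* = cmx (M^T).
Proof. by apply/matrixP => i j; rewrite !mxE conjC_toC. Qed.

Lemma symmetricmxP n (M : 'M[R]_n) : reflect (M^T = M) (M \is symmetricmx).
Proof.
by apply: (iffP (is_hermitianmxP _ _ _)); rewrite expr0 scale1r map_mx_id.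
Qed.

Lemma hermsymmx_toC n (M : 'M[R]_n) : 
  M \is symmetricmx -> cmx M \is hermsymmx.
Proof.
by move=> /symmetricmxP Ms; apply/hermsymmxP; rewrite trmxC_toC Ms.
Qed.

Lemma qf_toC n (M : 'M[R]_n) (x : 'cV[R]_n) :
  qf (cmx M) (cmx x) = ((x^T *m M *m x) 0 0)%:C.
Proof. by rewrite /qf trmxC_toC -!map_mxM mxE. Qed.

Lemma mx_ReIm m n (Z : 'M[R[i]]_(m, n)) :
  Z = cmx (map_mx (@complex.Re R) Z) + 'i%C *: cmx (map_mx (@complex.Im R) Z).
Proof. by apply/matrixP => i j; rewrite !mxE -complexE. Qed.

Lemma mx_ReIm_inj m n (P Q P' Q' : 'M[R]_(m, n)) :
  cmx P + 'i%C *: cmx Q = cmx P' + 'i%C *: cmx Q' -> P = P' /\ Q = Q'.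
Proof.
move=> E; split; apply/matrixP => i j.
  have := congr1 (fun M : 'M_(m, n) => complex.Re (M i j)) E.
  by rewrite !mxE /=; simpc.
have := congr1 (fun M : 'M_(m, n) => complex.Im (M i j)) E.
by rewrite !mxE /=; simpc.
Qed.

(** For [z = a + i b] the cross terms cancel by symmetry of [M], leaving the sum of the real forms
    at [a] and [b]. *)
Lemma qf_psd_toC n (M : 'M[R]_n) (z : 'cV[R[i]]_n) :
  psdmx M -> 0 <= qf (cmx M) z.
Proof.
move=> [/symmetricmxP Mt Mp].
rewrite [z]mx_ReIm.
set a := map_mx (@complex.Re R) z; set b := map_mx (@complex.Im R) z.
have -> : qf (cmx M) (cmx a + 'i%C *: cmx b)
  = qf (cmx M) (cmx a) + qf (cmx M) (cmx b).
  have ab : a^T *m M *m b = b^T *m M *m a.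
    apply/matrixP => i j; rewrite !ord1.
    have : (b^T *m M *m a)^T 0 0 = (b^T *m M *m a) 0 0 by rewrite mxE.
    by rewrite !trmx_mul trmxK Mt mulmxA.
  rewrite /qf trmxCD trmxCZ mulmxDr !mulmxDl.
  rewrite -!scalemxAr -!scalemxAl scalerA !trmxC_toC -!map_mxM ab.
  have -> : ('i%C)^*%R = - 'i%C :> R[i].
    by apply/eqP; rewrite eq_complex /= oppr0 !eqxx.
  by rewrite mulrN -expr2 sqr_i opprK scale1r scaleNr addrA subrK [LHS]mxE.
by rewrite !qf_toC addr_ge0 // ler0c.
Qed.

(** The linear terms are products of [A] and [X], so the two signs cancel; the quadratic term is
    even in [X]. *)
Lemma riccati_ineq_set_opp n m (A : 'M[R]_n) (B : 'M[R]_(n, m)) X :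
  riccati_ineq_set A B X -> riccati_ineq_set (- A) B (- X).
Proof.
move=> [/symmetricmxP Xs XR]; split.
  by apply/symmetricmxP; rewrite linearN /= Xs.
by rewrite [(- A)^T]linearN /= !mulmxN !mulNmx !opprK.
Qed.

Lemma riccati_bounded_above n m (A : 'M[R]_n) (B : 'M[R]_(n, m)) :
  (forall l, uncontrollable_eigenvalue A B l -> complex.Re l < 0) ->
  bounded_above (riccati_ineq_set A B).
Proof.
move=> H; have [|c c0 Hc] := @riccati_ineq_upper_bound _ _ _ (cmx A) (cmx B).
  move=> l v v0 vA vB; rewrite ReC ltcR; apply: H; exists v^T; split.
  - by rewrite trmx_eq0.
  - by rewrite -trmx_mul vA linearZ.
  - by rewrite -trmx_mul vB trmx0.
(* Being positive, [c] is a real number [k], and the scalar matrix [k] serves as the upper bound. *)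
have [k ck] := complex_realP c (gtr0_real c0).
have ks : k%:M^T = k%:M :> 'M[R]_n by rewrite tr_scalar_mx.
exists k%:M; split; first exact/symmetricmxP.
move=> X [/[dup] /symmetricmxP Xs Xsym XR]; split.
  by apply/symmetricmxP; rewrite linearB /= Xs ks.
move=> x; rewrite mulmxBr mulmxBl mxE [X in _ + X]mxE subr_ge0 -lecR -qf_toC.
apply: le_trans (Hc (cmx X) (hermsymmx_toC Xsym) _ (cmx x)) _; last first.
  rewrite ck -(map_mx1 toC) qf_toC -rmorphM -(scalemx1 _ k) -scalemxAr.
  by rewrite -scalemxAl [fun_of_matrix (k *: _) _ _]mxE.
move=> z; have := qf_psd_toC z XR; congr (0 <= qf _ z).
rewrite /lyap !trmxC_toC -!map_mxM -!(map_mxD, map_mxB) sub0r; congr (cmx _).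
by rewrite !opprD !opprK.
Qed.

(** * Rays of solutions and unboundedness *)

Lemma riccati_ineq_ray n m (A : 'M[R]_n) (B : 'M[R]_(n, m)) l :
  uncontrollable_eigenvalue A B l ->
  exists (S : 'M[R]_n) (x : 'cV[R]_n), 0 < (x^T *m S *m x) 0 0 /\
    forall t, 0 <= t * complex.Re l -> riccati_ineq_set A B (t *: S).
Proof.
move=> [v [v0 vA vB]].
pose p := map_mx (@complex.Re R) v; pose q := map_mx (@complex.Im R) v.
have vE : v = cmx p + 'i%C *: cmx q := mx_ReIm v.
set a := complex.Re l; pose b := complex.Im l.
have [pA qA] : A^T *m p = a *: p - b *: q /\ A^T *m q = a *: q + b *: p.
  apply: mx_ReIm_inj; move: vA.
  rewrite {1}vE mulmxDr -scalemxAr map_trmx -!map_mxM => ->.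
  apply/matrixP => i j; rewrite !mxE [l]complexE -/a -/b.
  by rewrite [v i j]complexE; simpc; congr (_ +i* _); ring.
have [pB qB] : B^T *m p = 0 /\ B^T *m q = 0.
  apply: mx_ReIm_inj; move: vB.
  rewrite {1}vE mulmxDr -scalemxAr map_trmx -!map_mxM => ->.
  by rewrite !map_mx0 scaler0 addr0.
(* [S] is the real part of [v v^*]. *)
pose S := p *m p^T + q *m q^T.
have SE (x : 'cV[R]_n) :
  (x^T *m S *m x) 0 0 = (x^T *m p) 0 0 ^+ 2 + (x^T *m q) 0 0 ^+ 2.
  have sq (u : 'cV[R]_n) : (x^T *m (u *m u^T) *m x) 0 0 = (x^T *m u) 0 0 ^+ 2.
    rewrite mulmxA -mulmxA -{2}[x]trmxK -trmx_mul mxE big_ord1.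
    by rewrite [X in _ * X]mxE -expr2.
  by rewrite mulmxDr mulmxDl mxE !sq.
have ss (x : 'cV[R]_n) : x != 0 -> 0 < (x^T *m x) 0 0 ^+ 2.
  move=> /matrix0Pn [i [j]]; rewrite ord1 => xi.
  rewrite exprn_gt0 // mxE (bigD1 i) //= ltr_pwDl //.
    by rewrite mxE -expr2 exprn_even_gt0.
  by rewrite sumr_ge0 // => k _; rewrite mxE -expr2 sqr_ge0.
have St : S^T = S by rewrite linearD /= !trmx_mul !trmxK.
(* Since [v] is nonzero, [p] or [q] is, and a nonzero one of them is a witness. *)
have [x x0] : exists x : 'cV[R]_n, 0 < (x^T *m S *m x) 0 0.
  have [pz|pn0] := eqVneq p 0.
    exists q; rewrite SE ltr_wpDl ?sqr_ge0 // ss //.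
    by apply: contra_neq v0 => qz; rewrite vE pz qz !map_mx0 scaler0 addr0.
  by exists p; rewrite SE ltr_pwDl ?sqr_ge0 // ss.
exists S, x; split=> // t ta; split.
  by apply/symmetricmxP; rewrite linearZ /= St.
have SB : S *m B = 0.
  apply: trmx_inj; rewrite trmx_mul St mulmxDr !mulmxA pB qB !mul0mx addr0.
  by rewrite trmx0.
(* In [A^T S] the terms in [b] form an antisymmetric matrix, which cancels against its transpose. *)
have AS : A^T *m S + S *m A = (2 * a) *: S.
  have -> : S *m A = (A^T *m S)^T by rewrite trmx_mul trmxK St.
  rewrite mulmxDr !mulmxA pA qA; apply/matrixP => i j.
  by rewrite !(mxE, big_ord1); ring.
rewrite /loewner_le -!scalemxAl -scalemxAr SB !mul0mx !scaler0 addr0 sub0r.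
rewrite -opprD opprK -scalerDr AS scalerA; split.
  by apply/symmetricmxP; rewrite linearZ /= St.
move=> y; rewrite -scalemxAr -scalemxAl mxE SE mulr_ge0 //.
  by rewrite mulrCA mulr_ge0.
by rewrite addr_ge0 ?sqr_ge0.
Qed.

Lemma riccati_unbounded_below n m (A : 'M[R]_n) (B : 'M[R]_(n, m)) l :
  uncontrollable_eigenvalue A B l -> complex.Re l < 0 ->
  ~ bounded_below (riccati_ineq_set A B).
Proof.
move=> /riccati_ineq_ray [S [x [Sx H]]] l0 [N [_ HN]].
(* With this [k] the form of [- k S] at [x] is [-1 - |x^T N x|], strictly below that of [N]. *)
pose k := (1 + `|(x^T *m N *m x) 0 0|) / (x^T *m S *m x) 0 0.
have k0 : 0 < k by rewrite divr_gt0 // ltr_pwDl.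
have [] := HN (- k *: S) (H _ _).
  by rewrite mulNr oppr_ge0 mulr_ge0_le0 ?ltW.
move=> _ /(_ x); rewrite mulmxBr mulmxBl -scalemxAr -scalemxAl.
rewrite mxE [X in _ + X]mxE [fun_of_matrix (_ *: _) _ _]mxE mulNr.
rewrite divfK ?gt_eqF //.
have := ler_norm (- (x^T *m N *m x) 0 0); rewrite normrN => le_N.
rewrite leNgt (_ : _ - _ < 0) // subr_lt0 ltrNl.
by rewrite (le_lt_trans le_N) // ltrDr.
Qed.

Lemma uncontrollable_eigenvalue_opp n m (A : 'M[R]_n) (B : 'M[R]_(n, m)) l :
  uncontrollable_eigenvalue (- A) B l -> uncontrollable_eigenvalue A B (- l).
Proof.
move=> [v [v0 vA vB]]; exists v; split=> //.
by rewrite scaleNr -vA map_mxN linearN /= mulNmx opprK.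
Qed.

Lemma bounded_below_of_opp n m (A : 'M[R]_n) (B : 'M[R]_(n, m)) :
  bounded_above (riccati_ineq_set (- A) B) ->
  bounded_below (riccati_ineq_set A B).
Proof.
move=> [N [/symmetricmxP Ns HN]]; exists (- N); split.
  by apply/symmetricmxP; rewrite linearN /= Ns.
move=> X /riccati_ineq_set_opp /HN; rewrite /loewner_le.
by rewrite !opprK addrC.
Qed.

End Complexify.

Local Close Scope sesquilinear_scope.

Theorem theorem10 (R : realType) (n m : nat)
    (A0 : 'M[R]_n) (B : 'M[R]_(n, m)) :
  ~ controllable A0 B ->
  [/\ (forall lam : R[i], uncontrollable_eigenvalue A0 B lam ->
         0 < complex.Re lam) ->
      bounded_below (riccati_ineq_set A0 B),
      (forall lam : R[i], uncontrollable_eigenvalue A0 B lam ->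
         complex.Re lam < 0) ->
      bounded_above (riccati_ineq_set A0 B)
    & (exists lam : R[i], uncontrollable_eigenvalue A0 B lam /\
         complex.Re lam < 0) ->
      (exists lam : R[i], uncontrollable_eigenvalue A0 B lam /\
         0 < complex.Re lam) ->
      ~ bounded_below (riccati_ineq_set A0 B) /\
      ~ bounded_above (riccati_ineq_set A0 B)].
Proof.
move=> _; split=> [Re_gt0|Re_lt0|[l [lA l0]] [l' [l'A l'0]]].
- apply: bounded_below_of_opp; apply: riccati_bounded_above => l.
  by move=> /uncontrollable_eigenvalue_opp /Re_gt0; rewrite raddfN /= oppr_gt0.
- exact: riccati_bounded_above.
split; first exact: riccati_unbounded_below lA l0.
(* A bound from above for [A0] is one from below for [- A0], which has the uncontrollable eigenvalue
   [- l'] in the left half plane. *)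
rewrite -[A0]opprK => /bounded_below_of_opp.
apply: (@riccati_unbounded_below _ _ _ _ _ (- l')); last first.
  by rewrite raddfN oppr_lt0.
by apply: uncontrollable_eigenvalue_opp; rewrite !opprK.
Qed.
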